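(* Let $G=\mathbb{Z}_r=\mathbb{Z}/r\mathbb{Z}$ be the cyclic group of order $r$ and let $V=G_1\oplus G_{r-1}$. Let $A$ be the adjacency matrix of the McKay quiver of $(G,V)$ (a circular graph with $r$ nodes $0,1,\dots,r-1$). Then for all $a,c\in\{0,1,\dots,r-1\}$ and all integers $k\ge 0$, the number of walks of $k$ steps from $a$ to $c$ is $$(A^k)_{a,c}=\sum_{\substack{0\le\ell\le k\\ k-2\ell\,\equiv\,c-a \bmod r}}\binom{k}{\ell}.$$
   Context: For $a\in\mathbb{Z}_r$, $G_a$ is the one-dimensional complex $\mathbb{Z}_r$-module with character $\chi_a(b)=\omega^{ab}$, where $\omega=e^{2\pi i/r}$. The McKay quiver of $(G,V)$ is the directed multigraph with node set $\{0,1,\dots,r-1\}=\mathbb{Z}_r$ (labeling the irreducible modules $G_a$) having $a_{\nu,\lambda}$ arrows from $\nu$ to $\lambda$, where $a_{\nu,\lambda}$ is the multiplicity of $G_\lambda$ in $G_\nu\otimes V$; its adjacency matrix is $A=(a_{\nu,\lambda})$. *)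

(* Defs.v *)
From HB Require Import structures.
From mathcomp Require Import all_boot all_order all_fingroup all_algebra.
From mathcomp Require Import all_solvable all_field all_character.
From mathcomp Require Import boolp reals trigo.
From mathcomp Require Import complex.

Set Implicit Arguments.
Unset Strict Implicit.
Unset Printing Implicit Defensive.

Import GRing.Theory Num.Theory.

Local Open Scope ring_scope.

(* A quiver is a directed multigraph, loops allowed. *)
Record quiver (N : finType) := Quiver {
  arrow : finType;
  source : arrow -> N;
  target : arrow -> N
}.

Section QuiverTheory.

Variables (m : nat) (Q : quiver 'I_m).

Definition adjacency : 'M[nat]_m :=
  \matrix_(i, j) #|[set e : arrow Q | (source e == i) && (target e == j)]|.

(* Walks are sequences of composable arrows, so that parallel arrows yield
   different walks; the empty walk joins every node to itself only. *)
Fixpoint is_walk (a c : 'I_m) (w : seq (arrow Q)) : bool :=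
  if w is e :: w' then (source e == a) && is_walk (target e) c w' else a == c.

Definition walks (k : nat) (a c : 'I_m) : {set k.-tuple (arrow Q)} :=
  [set w : k.-tuple (arrow Q) | is_walk a c w].

End QuiverTheory.

Section Multiplicity.

Variables (F : decFieldType) (gT : finGroupType) (G : {group gT}).

(* Multiplicity of the irreducible representation S in W. The sum has at most
   one term: DecSocleType W enumerates the isotypic components of W, with
   pairwise non-isomorphic simple constituents. *)
Definition irr_mult (S W : representation F G) : nat :=
  (\sum_(C : DecSocleType W | `[< mx_rsim (socle_repr C) S >]) socle_mult C)%N.

Definition tensor (S W : representation F G) : representation F G :=
  Representation (prod_repr S W).

(* S is meant to list the irreducible representations of G; the arrows from i
   to j are numbered by the multiplicity of S j in S i (x) V. *)
Definition mckay_quiver (m : nat) (S : 'I_m -> representation F G)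
    (V : representation F G) : quiver 'I_m :=
  @Quiver _ {p : 'I_m * 'I_m & 'I_(irr_mult (S p.2) (tensor (S p.1) V))}
    (fun e => (tag e).1) (fun e => (tag e).2).

Lemma adjacency_mckay (m : nat) (S : 'I_m -> representation F G)
    (V : representation F G) (i j : 'I_m) :
  adjacency (mckay_quiver S V) i j = irr_mult (S j) (tensor (S i) V).
Proof.
rewrite mxE.
pose T (p : 'I_m * 'I_m) := 'I_(irr_mult (S p.2) (tensor (S p.1) V)).
pose f (x : T (i, j)) : arrow (mckay_quiver S V) := Tagged T x.
have f_inj : injective f by move=> x y /eqP; rewrite eq_Tagged => /eqP.
rewrite -[RHS]card_ord -(card_imset predT f_inj); apply: eq_card => -[[a b] x].
rewrite inE /=; apply/andP/imsetP => [[/eqP ea /eqP eb]|[y _ e]].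
  by subst; exists x.
by have := congr1 tag e => -[-> ->].
Qed.

End Multiplicity.

Section CyclicGroup.

Variables (R : realType) (n : nat).

(* e^{2 pi i / r} for r = n.+1 *)
Definition omega : R[i] :=
  (cos (2 * pi / n.+1%:R) +i* sin (2 * pi / n.+1%:R))%C.

Lemma omega_unity : omega ^+ n.+1 = 1.
Proof.
rewrite /omega; set t := 2 * pi / _.
have moivre k : (cos t +i* sin t)%C ^+ k = (cos (t *+ k) +i* sin (t *+ k))%C.
  elim: k => [|k IHk]; first by rewrite expr0 !mulr0n cos0 sin0.
  by rewrite exprS IHk [t *+ k.+1]mulrS cosD sinD [sin t * _ + _]addrC.
have tr : t *+ n.+1 = 0 + pi *+ 2.
  by rewrite add0r /t -[LHS]mulr_natr divfK ?pnatr_eq0 // mulr_natl.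
by rewrite moivre tr cosD2pi sinD2pi cos0 sin0.
Qed.

(* 'I_n.+1 is the additive group Z/rZ with r = n.+1 (written multiplicatively
   in group_scope); the natural number a stands for its class modulo r. *)
Definition cyclic_mx_fun (a : nat) (b : 'I_n.+1) : 'M[R[i]]_1 :=
  (omega ^+ (a * b))%:M.

Lemma cyclic_mx_repr a : mx_repr [set: 'I_n.+1] (cyclic_mx_fun a).
Proof.
split=> [|x y _ _]; rewrite /cyclic_mx_fun; first by rewrite muln0 expr0.
rewrite -scalar_mxM -exprD -mulnDr -(expr_mod _ omega_unity) /=.
by rewrite -[in RHS](expr_mod _ omega_unity) modnMmr.
Qed.

Definition cyclic_module (a : nat) : representation R[i] [set: 'I_n.+1] :=
  Representation (MxRepresentation (cyclic_mx_repr a)).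

End CyclicGroup.

(* Main.v *)
Require Import Defs.
From mathcomp Require Import all_boot all_order all_fingroup all_algebra.
From mathcomp Require Import all_character.
From mathcomp Require Import boolp reals trigo complex.
From mathcomp Require Import ring lra zify.

(** If a group is generated by [x] and [S] is one-dimensional, then the
    multiplicity of [S] in [W] is the dimension of the eigenspace of [x] on [W]
    for the scalar by which [x] acts on [S]: a nonzero eigenspace is exactly one
    isotypic component. On [G_i (x) (G_1 (+) G_(r-1))] the generator acts as
    [diag (omega^(i+1), omega^(i+r-1))], and [omega] is a primitive [r]-th root
    of unity, so the quiver has one arrow from [i] to each of [i + 1] and
    [i - 1] (two parallel ones when [r <= 2]). Hence the entries of [A ^+ k]
    satisfy Pascal's recurrence, with [k - 2 l] the net displacement of a walk
    having [l] backward steps. *)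

Set Implicit Arguments.
Unset Strict Implicit.
Unset Printing Implicit Defensive.

Import Order.TTheory GRing.Theory Num.Theory.

Local Open Scope ring_scope.

Section LinearMultiplicity.

Variables (F : decFieldType) (gT : finGroupType) (G : {group gT}).
Variables (rS : mx_representation F G 1) (n : nat) (rW : mx_representation F G n).

(** The degree is a variable equal to 1 because it gets instantiated by [\rank U], which is not
    convertible to 1. *)
Lemma mx_rsim_linear m (rU : mx_representation F G m) :
  m = 1%N -> {in G, forall g, rU g = (rS g 0 0)%:M} -> mx_rsim rU rS.
Proof.
move=> m1; rewrite {m}m1 in rU * => rUE.
exists 1%:M => [//||g Gg]; first by rewrite row_free_unit unitmx1.
by rewrite mulmx1 mul1mx rUE // [RHS]mx11_scalar.
Qed.

Variable x : gT.
Hypothesis defG : G :=: <[x]>%g.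

Local Notation E := (eigenspace (rW x) (rS x 0 0)).

Let Gx : x \in G. Proof. by rewrite defG cycle_id. Qed.

(** Each [g] is a power of [x], and both actions are multiplicative in it. *)
Lemma eigenspace_genE m (U : 'M_(m, n)) g :
  g \in G -> (U <= E)%MS -> U *m rW g = rS g 0 0 *: U.
Proof.
rewrite {1}defG => /cycleP[i ->] /eigenspaceP Ux.
elim: i => [|i IHi]; first by rewrite !repr_mx1 mulmx1 mxE eqxx scale1r.
rewrite expgS !repr_mxM ?groupX // mulmxA Ux -scalemxAl IHi scalerA.
by rewrite mxE big_ord1.
Qed.

Lemma submod_repr_eigenspace (U : 'M_n) (modU : mxmodule rW U) :
  (U <= E)%MS -> {in G, forall g, submod_repr modU g = (rS g 0 0)%:M}.
Proof.
move=> sUE g Gg; apply: val_submod_inj.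
rewrite -[submod_repr _ _]mul1mx val_submodJ //.
rewrite eigenspace_genE ?(submx_trans (val_submodP _)) //.
by rewrite -(scalemx1 _ (rS g 0 0)) [RHS]val_submodE -scalemxAl mul1mx.
Qed.

Lemma rsim_sub_eigenspace (U : 'M_n) (modU : mxmodule rW U) :
  mx_rsim (submod_repr modU) rS -> (U <= E)%MS.
Proof.
move=> rsimU; rewrite -val_submod1; apply/eigenspaceP.
rewrite -val_submodJ // mul1mx.
rewrite -/(submod_repr modU x) (mx_rsim_scalar Gx (mx_rsim_sym rsimU) (mx11_scalar _)).
by rewrite -(scalemx1 _ (rS x 0 0)) [LHS]val_submodE -scalemxAl mul1mx.
Qed.

Lemma irr_mult_eigenspace :
  irr_mult (Representation rS) (Representation rW) = \rank E.
Proof.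
have rsimE (U : 'M_n) (modU : mxmodule rW U) :
    \rank U = 1%N -> (U <= E)%MS -> mx_rsim (submod_repr modU) rS.
  by move=> U1 sUE; apply: mx_rsim_linear => //; apply: submod_repr_eigenspace.
rewrite /irr_mult /=; case: (eqVneq E 0) => [E0|].
  rewrite E0 mxrank0 big1 // => C /asboolP/rsim_sub_eigenspace.
  by rewrite E0 submx0 => C0; case: (socle_simple C) => _ /negP[].
case/rowV0Pn=> v svE nzv.
have line_mod (u : 'rV_n) : (u <= E)%MS -> mxmodule rW <<u>>%MS.
  move=> suE; apply/mxmoduleP=> g Gg; rewrite (eqmxMr _ (genmxE u)) genmxE.
  by rewrite eigenspace_genE // scalemx_sub.
have line_sim (u : 'rV_n) : (u <= E)%MS -> u != 0 ->
    {simu : mxsimple rW <<u>>%MS | mx_rsim (submod_repr (mxsimple_module simu)) rS}.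
  move=> suE nzu; have u1 : \rank <<u>>%MS = 1%N by rewrite genmxE rank_rV nzu.
  have simu : mxsimple rW <<u>>%MS by apply: linear_mxsimple (line_mod u suE) u1.
  by exists simu; apply: rsimE => //; rewrite genmxE.
have [simv rsimv] := line_sim v svE nzv.
pose C : DecSocleType rW := PackSocle (component_socle (DecSocleType rW) simv).
(* The component is a sum of copies of the line of [v], each inside [E]; conversely, each nonzero
   row of [E] spans a line isomorphic to that of [v]. *)
have CE : (C :=: E)%MS.
  apply/eqmxP/andP; split; rewrite PackSocleK.
    have [I [W isoW ->]] := component_mx_def simv.
    apply/sumsmx_subP=> i _; have simW := mx_iso_simple (isoW i) simv.
    apply: (@rsim_sub_eigenspace _ (mxsimple_module simW)).
    by apply: mx_rsim_trans rsimv; apply/mx_rsim_iso/mx_iso_sym.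
  apply/row_subP=> i; have [-> | nzi] := eqVneq (row i E) 0; first exact: sub0mx.
  have [simi rsimi] := line_sim _ (row_sub i E) nzi.
  apply: (@submx_trans _ _ _ _ _ _ <<row i E>>%MS); first by rewrite genmxE.
  apply: mx_iso_component => //.
  by have /mx_rsim_iso := mx_rsim_trans rsimv (mx_rsim_sym rsimi).
have rsimC : mx_rsim (socle_repr C) rS.
  apply: mx_rsim_trans rsimv; apply/mx_rsim_iso/mx_iso_sym.
  apply: component_mx_iso (socle_simple C) _ => //.
  have <- : C = component_mx rW <<v>>%MS :> 'M_n by apply: PackSocleK.
  exact: component_mx_id (socle_simple C).
(* A component similar to [rS] is isomorphic, hence equal, to [C]; its multiplicity is its rank
   divided by 1, the degree of [rS]. *)
rewrite (big_pred1 C) => [|C'].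
  by rewrite /socle_mult CE (mxrank_rsim rsimC) divn1.
apply/asboolP/socle_rsimP => [rsimC' | isoC].
  exact: mx_rsim_trans rsimC' (mx_rsim_sym rsimC).
exact: mx_rsim_trans isoC rsimC.
Qed.

End LinearMultiplicity.

Lemma card_walks m (Q : quiver 'I_m) k a c :
  #|walks Q k a c| = (adjacency Q ^+ k) a c.
Proof.
elim: k a => [|k IHk] a.
  rewrite expr0 mxE cardsE; case: eqVneq => [<-|ac].
    rewrite (eq_card (B := predT)) ?card_tuple // => w.
    by rewrite [w]tuple0 unfold_in /= eqxx.
  by apply: eq_card0 => w; rewrite [w]tuple0 unfold_in /= (negPf ac).
pose f (p : arrow Q * k.-tuple (arrow Q)) := [tuple of p.1 :: p.2].
have f_bij : bijective f.
  exists (fun w => (thead w, [tuple of behead w])) => [[e w]|w].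
    by congr pair; apply: val_inj.
  by rewrite /f /= [RHS]tuple_eta.
rewrite exprS mxE -sum1_card (reindex f) /=; last exact: onW_bij.
rewrite (eq_bigl (fun p : arrow Q * k.-tuple (arrow Q) =>
  (source p.1 == a) && is_walk (target p.1) c p.2)); last by move=> p; rewrite inE.
rewrite -(pair_big_dep (fun e => source e == a)
  (fun e (w : k.-tuple (arrow Q)) => is_walk (target e) c w) (fun _ _ => 1%N)) /=.
(* Grouping the first arrows by target [b] produces the matrix product. *)
rewrite (partition_big (@target _ Q) predT) //=; apply: eq_bigr => b _.
rewrite -IHk mxE -sum1dep_card [RHS]big_distrl /=; apply: eq_bigr => e /andP[_ /eqP->].
by rewrite mul1r sum1dep_card.
Qed.

Definition residue_binomial_sum (r k : nat) (d : int) : nat :=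
  (\sum_(l < k.+1 | (k%:Z - 2 * l%:Z == d %[mod r%:Z])%Z) 'C(k, l))%N.

Lemma eq_residue_binomial_sum r k d d' :
  (d = d' %[mod r%:Z])%Z -> residue_binomial_sum r k d = residue_binomial_sum r k d'.
Proof. by move=> dd'; rewrite /residue_binomial_sum dd'. Qed.

(** Pascal's rule: [k + 1 - 2 (l + 1)] is congruent to [d] iff [k - 2 (l + 1)] is to [d - 1], iff
    [k - 2 l] is to [d + 1]. *)
Lemma residue_binomial_sumS r k d :
  residue_binomial_sum r k.+1 d =
    (residue_binomial_sum r k (d - 1) + residue_binomial_sum r k (d + 1))%N.
Proof.
have modE x y z t : x - y = z - t -> (x == y %[mod r%:Z])%Z = (z == t %[mod r%:Z])%Z.
  by move=> e; rewrite !eqz_mod_dvd e.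
rewrite /residue_binomial_sum !(big_mkcond (fun _ => _ == _)) /=.
rewrite big_ord_recl /= (eq_bigr (fun l : 'I_k.+1 =>
  (if (k%:Z - 2 * l.+1%:Z == d - 1 %[mod r%:Z])%Z then 'C(k, l.+1) else 0) +
  (if (k%:Z - 2 * l%:Z == d + 1 %[mod r%:Z])%Z then 'C(k, l) else 0)))%N; last first.
  move=> l _; rewrite /bump /= add1n binS.
  rewrite -(modE (k.+1%:Z - 2 * l.+1%:Z) d); last by lia.
  rewrite -(modE (k.+1%:Z - 2 * l.+1%:Z) d); last by lia.
  by case: ifP.
rewrite big_split addnA /=; congr addn.
(* The top term ['C(k, k.+1)] vanishes, and the split-off term [l = 0] completes the sum for
   [d - 1]. *)
rewrite [in LHS]big_ord_recr /= (bin_small (ltnSn k)) if_same addn0.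
rewrite [in RHS]big_ord_recl /= !bin0; congr addn.
by rewrite (modE _ _ (k%:Z - 2 * 0%:Z) (d - 1)) //; lia.
Qed.

(** Adding two indicators gives the entry 2 when successor and predecessor coincide. The induction
    follows the first step of a walk. *)
Lemma expr_circular_mx n (A : 'M[nat]_n.+1) k a c :
    (forall i j, A i j = ((j == ordS i) + (j == ord_pred i))%N) ->
  (A ^+ k) a c = residue_binomial_sum n.+1 k (c%:Z - a%:Z).
Proof.
move=> AE; elim: k a => [|k IHk] a.
  rewrite expr0 mxE /residue_binomial_sum big_mkcond big_ord1 /= bin0 eqz_mod_dvd.
  have -> : 0%:Z - 2 * 0%:Z - (c%:Z - a%:Z) = a%:Z - c%:Z by ring.
  by rewrite -eqz_mod_dvd !modz_nat eqz_nat !modn_small // -val_eqE; case: eqP.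
rewrite exprS mxE residue_binomial_sumS.
rewrite (eq_bigr (fun b => (if b == ordS a then (A ^+ k) b c else 0) +
   (if b == ord_pred a then (A ^+ k) b c else 0)))%N; last first.
  by move=> b _; rewrite AE mulrDl; do 2 case: eqP; rewrite ?mul1r ?mul0r.
rewrite big_split /= -!big_mkcond /= !big_pred1_eq !IHk.
(* Wrapping around the circle changes the displacement by a multiple of [r] only. *)
have mod_sub m : m%:Z - (m %% n.+1)%:Z = (m %/ n.+1)%:Z * n.+1%:Z.
  by rewrite {1}(divn_eq m n.+1) PoszD addrK PoszM.
congr addn; apply: eq_residue_binomial_sum; apply/eqP; rewrite eqz_mod_dvd /=.
  have -> : c%:Z - (a.+1 %% n.+1)%:Z - (c%:Z - a%:Z - 1) =
            a.+1%:Z - (a.+1 %% n.+1)%:Z by lia.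
  by rewrite mod_sub dvdz_mull.
have -> : c%:Z - ((a + n.+1).-1 %% n.+1)%:Z - (c%:Z - a%:Z + 1) =
          (a + n.+1).-1%:Z - ((a + n.+1).-1 %% n.+1)%:Z - n.+1%:Z by lia.
by rewrite mod_sub rpredB ?dvdz_mull.
Qed.

Lemma rank_eigenspace_block (F : fieldType) (a b l : F) :
  \rank (eigenspace (block_mx a%:M 0 0 b%:M : 'M_(1 + 1)) l) = ((a == l) + (b == l))%N.
Proof.
rewrite /eigenspace mxrank_ker (scalar_mx_block 1 1) opp_block_mx add_block_mx.
rewrite !oppr0 !addr0 -!raddfB /= rank_diag_block_mx.
have rk (x : F) : \rank (x%:M : 'M_1) = (x != 0).
  by rewrite rank_rV -scalemx1 scalemx_eq0 negb_or oner_eq0 andbT.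
by rewrite !rk !subr_eq0; do 2 case: eqP.
Qed.

Lemma rank_eigenspace_castmx (F : fieldType) m m' (e : m = m') (B : 'M[F]_m) l :
  \rank (eigenspace (castmx (e, e) B) l) = \rank (eigenspace B l).
Proof. by case: m' / e. Qed.

Section Cyclic.

Variables (R : realType) (n : nat).
Local Notation omega := (omega R n).

Lemma omegaX k : omega ^+ k =
  (cos (2 * pi / n.+1%:R *+ k) +i* sin (2 * pi / n.+1%:R *+ k))%C.
Proof.
rewrite /omega; set t := 2 * pi / _.
elim: k => [|k IHk]; first by rewrite expr0 !mulr0n cos0 sin0.
by rewrite exprS IHk [t *+ k.+1]mulrS cosD sinD [sin t * _ + _]addrC.
Qed.

(** If the order [m] were below [r], then [y = pi m / r] would lie strictly between 0 and [pi], so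
    [sin y > 0], while [cos (2 y) = 1] forces [sin y = 0]. *)
Lemma omega_primitive : n.+1.-primitive_root omega.
Proof.
have [//|m m_prim m_dvd] := prim_order_exists _ (omega_unity R n).
have [//|m_lt] := leqP n.+1 m.
  by rewrite leq_eqVlt ltnNge dvdn_leq // orbF => /eqP ->.
have m_gt0 := prim_order_gt0 m_prim.
have := prim_expr_order m_prim; rewrite omegaX => -[+ _].
have -> : 2 * pi / n.+1%:R *+ m = (pi * (m%:R / n.+1%:R)) *+ 2 :> R.
  by rewrite -[LHS]mulr_natr -[RHS]mulr_natr; ring.
set y := pi * _ => cos1.
have : 0 < sin y.
  apply: sin_gt0_pi; rewrite mulr_gt0 ?pi_gt0 ?divr_gt0 ?ltr0n //=.
  by rewrite gtr_pMr ?pi_gt0 // ltr_pdivrMr ?ltr0n // mul1r ltr_nat.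
move=> sin_gt0; have := cos2Dsin2 y; move: cos1; rewrite cos_mulr2n => cos1 cs1.
have /eqP : sin y ^+ 2 = 0 by lra.
by rewrite sqrf_eq0 gt_eqF.
Qed.

Lemma irr_mult_cyclic_module (i j : 'I_n.+1) :
  irr_mult (cyclic_module R n j)
    (tensor (cyclic_module R n i)
       (dadd_grepr (cyclic_module R n 1) (cyclic_module R n (n.+1 - 1)))) =
  ((j == ordS i) + (j == ord_pred i))%N.
Proof.
rewrite (irr_mult_eigenspace _ _ (Zp_cycle n)).
(* The value of [Zp1] is 1 modulo [r], thus 0 when [r = 1]; the reduction covers that case too. *)
have cE a : omega ^+ (a * (Zp1 : 'I_n.+1)) = omega ^+ a.
  by rewrite -(expr_mod _ (omega_unity R n)) modnMmr muln1 expr_mod // omega_unity.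
(* Tensoring with a one-dimensional module scales the other matrix, up to a cast from size [1 * 2]
   to 2. *)
rewrite prod_repr_lin ?inE //= rank_eigenspace_castmx /cyclic_mx_fun !cE !mxE eqxx.
rewrite scale_block_mx !scaler0 !scale_scalar_mx -!exprD rank_eigenspace_block.
(* Primitivity turns equal powers into exponents congruent modulo [r]. *)
rewrite !(eq_prim_root_expr omega_primitive) -!val_eqE /= addn1 subSS subn0 addnS /=.
by rewrite ![(_ %% _ == j %% _)%N]eq_sym !(modn_small (ltn_ord j)).
Qed.

End Cyclic.

Theorem mainTheorem5 (R : realType) (n : nat) (a c : 'I_n.+1) (k : nat) :
  let r := n.+1 in
  let V := dadd_grepr (cyclic_module R n 1) (cyclic_module R n (r - 1)%N) in
  let Q := mckay_quiver (fun v : 'I_n.+1 => cyclic_module R n v) V in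
  let A := adjacency Q in
  #|walks Q k a c| = (A ^+ k) a c /\
  (A ^+ k) a c =
    (\sum_(l < k.+1 | (k%:Z - 2 * l%:Z == c%:Z - a%:Z %[mod r%:Z])%Z) 'C(k, l))%N.
Proof.
move=> r V Q A; split; first exact: card_walks.
apply: expr_circular_mx => i j.
by rewrite adjacency_mckay irr_mult_cyclic_module.
Qed.
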